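(* Let $S$ be a set. If $\mathcal{K}_1$ and $\mathcal{K}_2$ are finite simplicial complexes over $S$, then $d(\mathcal{K}_1,\mathcal{K}_2)\in\mathbf{Q}$.
   Context: $\mathcal{P}_f^*(S)$ is the collection of all non-empty finite subsets of $S$. A simplicial complex over $S$ is a non-empty collection $\mathcal{K}\subset\mathcal{P}_f^*(S)$ such that every non-empty subset of an element of $\mathcal{K}$ belongs to $\mathcal{K}$; it is finite if it has finitely many elements. $\Omega=[0,1]$ with Lebesgue measure $\lambda$. $L(\mathcal{K})$ is the set of measurable maps $f:\Omega\to S$, identified when equal almost everywhere, such that $f(\Omega)\in\mathcal{K}$, where $f(\Omega)$ denotes the set $\{s\in S : \lambda(f^{-1}(s))>0\}$ and $f$ takes its values in this set almost everywhere. The metric is $d(f,g)=\lambda(\{t\in\Omega : f(t)\neq g(t)\})$. The distance between simplicial complexes is the Hausdorff distance $d(\mathcal{K}_1,\mathcal{K}_2)=\max(\delta(\mathcal{K}_1,\mathcal{K}_2),\delta(\mathcal{K}_2,\mathcal{K}_1))$ with $\delta(\mathcal{K}_1,\mathcal{K}_2)=\sup_{f\in L(\mathcal{K}_1)}\inf_{g\in L(\mathcal{K}_2)}d(f,g)$. *)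

(* Defs.v *)
From mathcomp Require Import all_boot all_order all_algebra.
From mathcomp Require Import all_classical all_reals all_analysis.

Set Implicit Arguments.
Unset Strict Implicit.
Unset Printing Implicit Defensive.

Import Order.TTheory GRing.Theory Num.Theory.
Import numFieldNormedType.Exports.

Local Open Scope classical_set_scope.
Local Open Scope ring_scope.
Local Open Scope ereal_scope.

Definition simplicial_complex (S : Type) (K : set (set S)) : Prop :=
  [/\ K !=set0,
      forall F, K F -> finite_set F /\ F !=set0 &
      forall F G, K F -> G `<=` F -> G !=set0 -> K G].

(* The measure [lambda] is the completed Lebesgue measure, whose sigma-algebra
   consists of all Lebesgue-measurable (not only Borel) sets; for [f], [g] in
   [L R K] the set where they differ is then always measurable, even though
   [S] may be uncountable.  Maps from Omega to S are represented by maps from R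
   to S, of which only the values on Omega matter. *)
Section Lebesgue.
Variable R : realType.

Definition Omega : set R := `[0%R, 1%R]%classic.

Definition lebesgue_measurable (A : set R) : Prop :=
  ((@wlength R idfun)^*%mu).-cara.-measurable A.

Definition lambda (A : set R) : \bar R := @completed_lebesgue_measure R A.

End Lebesgue.

Section RandomSimplices.
Variables (R : realType) (S : Type).
Implicit Types (f g : R -> S) (K : set (set S)).

(* S carries the discrete sigma-algebra.  [measurable_fun] is not used because
   the library's measurable types are pointed, whereas S is any set. *)
Definition measurable_map f : Prop :=
  forall A : set S, lebesgue_measurable (@Omega R `&` f @^-1` A).

Definition ess_image f : set S :=
  [set s | 0 < lambda (@Omega R `&` f @^-1` [set s])].

(* Elements are representatives of almost-everywhere classes.  Membership in
   [L K] and the value of [dist] depend only on these classes (the measure being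
   complete), so the suprema and infima below are those over the classes. *)
Definition L K : set (R -> S) :=
  [set f | [/\ measurable_map f,
               K (ess_image f) &
               lambda (@Omega R `&` [set t | ~ ess_image f (f t)]) = 0]].

Definition dist f g : \bar R := lambda (@Omega R `&` [set t | f t <> g t]).

Definition delta K1 K2 : \bar R :=
  ereal_sup [set ereal_inf [set dist f g | g in L K2] | f in L K1].

Definition complex_dist K1 K2 : \bar R := maxe (delta K1 K2) (delta K2 K1).

End RandomSimplices.
Arguments complex_dist R {S} K1 K2.

(* Main.v *)
Require Import Defs.
From mathcomp Require Import all_boot all_order all_algebra.
From mathcomp Require Import all_classical all_reals all_analysis.
From mathcomp Require Import lra.

(** Only the laws of the random simplices matter, and the Hausdorff distance
    turns out to be the maximum of finitely many values of matrix games with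
    entries 0 and 1, each of which is rational.

    Fix [f] with law [p]. A map [g] whose essential image is [G] differs from
    [f] at almost every point where [f] is outside [G]; conversely, retracting
    the values of [f] onto [G] yields a member of [L K2], because its essential
    image is a non-empty subset of [G], that differs from [f] only where [f] is
    outside [G]. So the distance from [f] to [L K2] is the minimum over [G] in
    [K2] of the mass that [p] gives to the complement of [G]
    ([le_ereal_inf_dist]). Every probability vector on a simplex [F] is the law
    of some map, obtained by cutting the unit interval into pieces
    ([exists_map_law]), so that [delta K1 K2] is the maximum, over the finitely
    many [F] in [K1], of the value of the game

      max over p in the simplex on F of min over G in K2 of p (F \ G).

    The numbers [t] that do not exceed this value are those for which a system
    of linear inequalities in [t] and the weights of [p], with rational
    coefficients, has a solution. Fourier-Motzkin elimination
    ([rational_cone_projection]) removes the unknown weights and leaves finitely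
    many rational inequalities in [t] alone, so these numbers form a half-line
    closed by a rational endpoint ([rational_cone_ray]). *)

Set Implicit Arguments.
Unset Strict Implicit.
Unset Printing Implicit Defensive.

Import Order.TTheory GRing.Theory Num.Theory.

Local Open Scope classical_set_scope.
Local Open Scope ring_scope.

(** * Rational linear systems and Fourier-Motzkin elimination *)

Section RationalCones.
Variable R : realFieldType.
Implicit Types (c d : nat -> rat) (x y : nat -> R) (P Q : set (nat -> R)).

(** Vectors are functions on [nat], so that systems in different numbers of
    unknowns live in one type and no casts appear when one is eliminated. *)
Definition linear_form n c x : R := \sum_(i < n) ratr (c i) * x i.

(** The systems are homogeneous; an affine one is encoded by giving the value 1
    to a distinguished coordinate. *)
Definition rational_cone n P : Prop :=
  exists cs : seq (nat -> rat),
    forall x, P x <-> (forall c, c \in cs -> 0 <= linear_form n c x).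

Lemma rational_cone_halfspace n c :
  rational_cone n [set x | 0 <= linear_form n c x].
Proof.
exists [:: c] => x; split=> [cx d|/(_ c)]; last by rewrite inE eqxx => /(_ isT).
by rewrite inE => /eqP ->.
Qed.

Lemma rational_coneT n : rational_cone n [set: nat -> R].
Proof. by exists [::]. Qed.

Lemma rational_coneI n P Q :
  rational_cone n P -> rational_cone n Q -> rational_cone n (P `&` Q).
Proof.
move=> [cs csP] [ds dsQ]; exists (cs ++ ds) => x; split.
  by move=> [/csP Px /dsQ Qx] c; rewrite mem_cat => /orP[/Px|/Qx].
move=> cdx; split.
  by apply/csP => c cc; apply: cdx; rewrite mem_cat cc.
by apply/dsQ => c cc; apply: cdx; rewrite mem_cat cc orbT.
Qed.

Lemma rational_cone_bigcap n m (P : nat -> set (nat -> R)) :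
  (forall i, (i < m)%N -> rational_cone n (P i)) ->
  rational_cone n (\bigcap_(i < m) P i).
Proof.
move=> PP; rewrite bigcap_mkord.
elim/big_ind : _ => [|? ?|i _]; [exact: rational_coneT|exact: rational_coneI|].
exact: PP.
Qed.

(** A real number lies between finitely many lower bounds and finitely many
    upper bounds as soon as the bounds are pairwise compatible; this is what
    makes an unknown eliminable. *)
Lemma seq_separation (lo up : seq R) :
  (forall a b, a \in lo -> b \in up -> a <= b) ->
  exists y : R,
    (forall a, a \in lo -> a <= y) /\ (forall b, b \in up -> y <= b).
Proof.
elim: lo => [_|a lo IH leup].
  elim: up => [|b up [y [_ yup]]]; first by exists 0.
  exists (Num.min b y); split=> // b'; rewrite inE => /predU1P[->|/yup yb'].
    by rewrite ge_min lexx.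
  by rewrite ge_min yb' orbT.
have [|y [loy yup]] := IH.
  by move=> a' b a'lo bup; apply: leup => //; rewrite inE a'lo orbT.
exists (Num.max a y); split=> [a'|b bup].
  by rewrite inE => /predU1P[->|/loy a'y]; rewrite le_max ?lexx ?a'y ?orbT.
by rewrite ge_max yup// leup ?mem_head.
Qed.

Lemma linear_form_recr n c x :
  linear_form n.+1 c x = linear_form n c x + ratr (c n) * x n.
Proof. by rewrite /linear_form big_ord_recr. Qed.

Lemma eq_linear_form n c x y : (forall i, (i < n)%N -> x i = y i) ->
  linear_form n c x = linear_form n c y.
Proof. by move=> xy; apply: eq_bigr => i _; rewrite xy. Qed.

Lemma linear_form_comb n c d (a b : rat) x :
  linear_form n (fun i => a * c i - b * d i) x =
  ratr a * linear_form n c x - ratr b * linear_form n d x.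
Proof.
rewrite /linear_form !mulr_sumr -sumrB; apply: eq_bigr => i _.
by rewrite rmorphB !rmorphM mulrBl !mulrA.
Qed.

(** Fourier-Motzkin elimination. An inequality with a positive coefficient at
    the last unknown bounds it from below, one with a negative coefficient from
    above, and the system is solvable in it exactly when each lower bound is at
    most each upper bound. These conditions are rational again. *)
Lemma rational_cone_projection n P : rational_cone n.+1 P ->
  rational_cone n
    [set x | exists2 y, (forall i, (i < n)%N -> y i = x i) & P y].
Proof.
move=> [cs csP].
pose pos := [seq c <- cs | 0 < c n].
pose neg := [seq c <- cs | c n < 0].
(* The last unknown cancels in this combination of [c] and [d], whose factors
   [c n] and [- d n] are positive. *)
exists ([seq c <- cs | c n == 0] ++
        [seq (fun i => c n * d i - d n * c i) | c <- pos, d <- neg]).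
move=> x; split=> [[y yx /csP Py] e|ex].
  rewrite mem_cat => /orP[|/allpairsP[[c d] /= [+ + ->]]].
    rewrite mem_filter => /andP[/eqP e0 /Py].
    by rewrite linear_form_recr e0 rmorph0 mul0r addr0 (eq_linear_form _ yx).
  rewrite !mem_filter => /andP[c0 /Py cy] /andP[d0 /Py dy].
  rewrite linear_form_comb -!(eq_linear_form _ yx).
  have c0R : 0 < ratr (c n) :> R by rewrite ltr0q.
  have d0R : ratr (d n) < 0 :> R by rewrite ltrq0.
  move: cy dy; rewrite !linear_form_recr => cy dy.
  have := mulr_ge0 (ltW c0R) dy.
  have : 0 <= - ratr (d n) * (linear_form n c y + ratr (c n) * y n).
    by rewrite mulr_ge0// oppr_ge0 ltW.
  lra.
have [a b|z [loz zup]] := @seq_separation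
    [seq - linear_form n c x / ratr (c n) | c <- pos]
    [seq - linear_form n d x / ratr (d n) | d <- neg].
  move=> /mapP[c cpos ->] /mapP[d dneg ->].
  have := ex (fun i => c n * d i - d n * c i).
  rewrite mem_cat (_ : _ \in [seq _ | _ <- _, _ <- _]) ?orbT; last first.
    by apply/allpairsP; exists (c, d).
  move: cpos dneg; rewrite !mem_filter linear_form_comb.
  move=> /andP[c0 _] /andP[d0 _] /(_ isT).
  have c0R : 0 < ratr (c n) :> R by rewrite ltr0q.
  have d0R : ratr (d n) < 0 :> R by rewrite ltrq0.
  move=> cd; rewrite ler_pdivrMr// mulrAC ler_ndivlMr//; lra.
exists (fun i => if i == n then z else x i).
  by move=> i; case: eqP => // ->; rewrite ltnn.
apply/csP => c cc.
rewrite linear_form_recr eqxx (@eq_linear_form _ _ _ x); last first.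
  by move=> i; case: eqP => // ->; rewrite ltnn.
have [cn0|cn0|cn0] := ltrgtP (c n) 0.
- have cnR : ratr (c n) < 0 :> R by rewrite ltrq0.
  have : z <= - linear_form n c x / ratr (c n).
    by apply: zup; apply/mapP; exists c => //; rewrite mem_filter cn0.
  rewrite ler_ndivlMr//; lra.
- have cnR : 0 < ratr (c n) :> R by rewrite ltr0q.
  have : - linear_form n c x / ratr (c n) <= z.
    by apply: loz; apply/mapP; exists c => //; rewrite mem_filter cn0.
  rewrite ler_pdivrMr//; lra.
- rewrite cn0 rmorph0 mul0r addr0; apply: ex.
  by rewrite mem_cat mem_filter cn0 eqxx cc.
Qed.

Lemma rational_cone_projections n m P : rational_cone (n + m) P ->
  rational_cone n
    [set x | exists2 y, (forall i, (i < n)%N -> y i = x i) & P y].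
Proof.
elim: m P => [|m IH] P; rewrite ?addn0.
  move=> [cs csP]; exists cs => x; split=> [[y yx /csP Py] c cc|cx].
    by rewrite -(eq_linear_form _ yx) Py.
  by exists x => //; apply/csP.
rewrite addnS => /rational_cone_projection/IH[cs csP].
exists cs => x; rewrite -csP; split=> [[y yx Py]|[y yx [z zy Pz]]].
  by exists y => //; exists y.
by exists z => // i ni; rewrite zy ?yx// ltn_addr.
Qed.

Lemma seq_min (s : seq rat) : s != [::] ->
  exists2 q, q \in s & forall u, u \in s -> q <= u.
Proof.
elim: s => // a [|b s] IH _.
  by exists a; rewrite ?mem_head// => u; rewrite inE => /eqP ->.
have [//|q qs qle] := IH; have [aq|/ltW qa] := leP a q.
  exists a; rewrite ?mem_head// => u; rewrite inE => /predU1P[->//|/qle].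
  exact: le_trans.
by exists q; [rewrite inE qs orbT|move=> u; rewrite inE => /predU1P[->//|/qle]].
Qed.

(** Along the line of the vectors [(1, t)] a rational cone is cut out by
    inequalities [a + b t >= 0] with [a] and [b] rational. If it is a half-line
    going down, no [b] is positive, and its endpoint is the least of the
    [- a / b] with [b < 0]. *)
Lemma rational_cone_ray P (t0 M : R) (pt := fun t : R => nth 0 [:: 1; t]) :
    rational_cone 2 P -> P (pt t0) ->
    (forall t t', P (pt t) -> t' <= t -> P (pt t')) ->
    (forall t, P (pt t) -> t <= M) ->
  exists q : rat, forall t, P (pt t) <-> t <= ratr q.
Proof.
move=> [cs csP] Pt0 Pdown PM.
have linear_formE c t : linear_form 2 c (pt t) = ratr (c 0) + ratr (c 1) * t.
  by rewrite /linear_form !big_ord_recl big_ord0 addr0/= mulr1.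
have c1 c : c \in cs -> c 1 <= 0.
  move=> cc; rewrite leNgt; apply/negP => c1.
  have c1R : 0 < ratr (c 1) :> R by rewrite ltr0q.
  (* Far enough to the left, this inequality would fail. *)
  pose t1 : R := Num.min t0 (- (ratr (c 0) + 1) / ratr (c 1)).
  have /csP/(_ _ cc) : P (pt t1).
    by apply: (Pdown t0) => //; rewrite ge_min lexx.
  have : t1 <= - (ratr (c 0) + 1) / ratr (c 1) by rewrite ge_min lexx orbT.
  by rewrite linear_formE ler_pdivlMr//; lra.
pose U := [seq - (c 0 / c 1) | c <- cs & c 1 < 0].
have PU t : P (pt t) <-> forall u, u \in U -> t <= ratr u.
  rewrite csP; split=> [Pt u /mapP[c]|tU c cc].
    rewrite mem_filter => /andP[c1lt /Pt + ->].
    have c1R : ratr (c 1) < 0 :> R by rewrite ltrq0.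
    by rewrite linear_formE rmorphN fmorph_div -mulNr ler_ndivlMr//; lra.
  have := c1 _ cc; rewrite le_eqVlt => /predU1P[c10|c1lt].
    by have /csP/(_ _ cc) := Pt0; rewrite !linear_formE c10 !rmorph0 !mul0r.
  have c1R : ratr (c 1) < 0 :> R by rewrite ltrq0.
  have : t <= ratr (- (c 0 / c 1)).
    by apply: tU; apply/mapP; exists c => //; rewrite mem_filter c1lt.
  by rewrite linear_formE rmorphN fmorph_div -mulNr ler_ndivlMr//; lra.
have [U0|/seq_min[q qU qmin]] := eqVneq U [::].
  have /PM : P (pt (M + 1)) by apply/PU => u; rewrite U0.
  by lra.
exists q => t; rewrite PU; split=> [/(_ _ qU)//|tq u /qmin].
by rewrite -(ler_rat R); apply: le_trans.
Qed.

End RationalCones.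

(** * Finite sets *)

Lemma finite_set_enum (T : Type) (A : set T) : finite_set A -> A !=set0 ->
  exists n (v : nat -> T), set_bij `I_n A v.
Proof.
move=> /finite_setP[n /card_set_bijP[f [fA finj fsurj]]] [a0 Aa0].
have /choice[v vP] : forall i, exists a, (i < n)%N -> A a /\ f a = i.
  move=> i; have [/fsurj[a Aa <-]|] := pselect (`I_n i); first by exists a.
  by exists a0.
exists n, v; split.
- by move=> i /vP[].
- move=> i j; rewrite !inE => /vP[_ fi] /vP[_ fj] vij.
  by rewrite -fi -fj vij.
- move=> a Aa; exists (f a); first exact: fA.
  by have [Av fv] := vP _ (fA _ Aa); apply: finj; rewrite ?inE.
Qed.

Lemma finite_argmax (T : Type) (A : set T) (q : T -> rat) :
  finite_set A -> A !=set0 ->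
  exists2 a, A a & forall b, A b -> q b <= q a.
Proof.
move=> finA A0; have [n [v [vA _ vsurj]]] := finite_set_enum finA A0.
case: n vA vsurj => [|n] vA vsurj.
  by case: A0 => a /vsurj[i].
have := @arg_maxP _ _ _ (@ord0 n) xpredT (q \o v) isT.
set i := [arg max_(_ > _) _]%O => -[{}i _ imax].
exists (v i); first exact/vA/ltn_ord.
by move=> b /vsurj[j jn <-]; apply: (imax (Ordinal jn)).
Qed.

(** * Lebesgue measure on the unit interval *)

Section LebesgueFacts.
Local Open Scope ereal_scope.
Variable R : realType.
Notation outer :=
  ((@wlength R idfun)^*%mu : {outer_measure set (ocitv_type R) -> \bar R}).
Implicit Types A B : set R.

Lemma lebesgue_measurable_itv (i : interval R) : lebesgue_measurable [set` i].
Proof. by apply: sub_caratheodory; exact: measurable_itv. Qed.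

Lemma lambda_itv (i : interval R) :
  lambda [set` i] = if i.1 < i.2 then (i.2 : \bar R) - i.1 else 0.
Proof. by rewrite -lebesgue_measure_itv. Qed.

Lemma lambda_set1 (a : R) : lambda [set a] = 0.
Proof. by rewrite -set_itv1 lambda_itv ltxx. Qed.

Lemma lambda_Omega : lambda (@Omega R) = 1.
Proof. by rewrite lambda_itv/= lte01 oppr0 adde0. Qed.

Lemma lambda0 : lambda (@set0 R) = 0.
Proof. exact: (measure0 (@completed_lebesgue_measure R)). Qed.

(** As a function of sets, [lambda] is the outer measure, so monotonicity and
    subadditivity hold for arbitrary sets; measurability is needed only for
    additivity. *)
Lemma lambda_ge0 A : 0 <= lambda A.
Proof. exact: (outer_measure_ge0 outer A). Qed.

Lemma le_lambda A B : A `<=` B -> lambda A <= lambda B.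
Proof. exact: (@le_outer_measure R R outer A B). Qed.

Lemma lambdaU_le A B : lambda (A `|` B) <= lambda A + lambda B.
Proof. exact: (outer_measureU2 outer A B). Qed.

Lemma lambdaU0 A B : lambda B = 0 -> lambda (A `|` B) = lambda A.
Proof.
move=> B0; apply/eqP; rewrite eq_le; apply/andP; split; last first.
  exact/le_lambda/subsetUl.
by rewrite -[leRHS]adde0 -B0 lambdaU_le.
Qed.

Lemma lebesgue_measurable_sub1 A (a : R) :
  A `<=` [set a] -> lebesgue_measurable A.
Proof.
move=> /subset_set1[->|->]; first exact: measurable0.
by rewrite -set_itv1; exact: lebesgue_measurable_itv.
Qed.

End LebesgueFacts.

Section Mass.
Local Open Scope ereal_scope.
Variables (R : realType) (S : Type).
Implicit Types (f g : R -> S) (A B F G : set S).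

(** The law of [f], as a random variable on the unit interval. *)
Definition mass f A : \bar R := lambda (@Omega R `&` f @^-1` A).

Lemma mass_ge0 f A : 0 <= mass f A.
Proof. exact: lambda_ge0. Qed.

Lemma le_mass f A B : A `<=` B -> mass f A <= mass f B.
Proof. by move=> AB; apply: le_lambda => t [Ot /AB]. Qed.

Lemma mass_setT f : mass f setT = 1.
Proof. by rewrite /mass preimage_setT setIT lambda_Omega. Qed.

Lemma mass_le1 f A : mass f A <= 1.
Proof. by rewrite -(mass_setT f); apply: le_mass. Qed.

Lemma mass_fin_num f A : mass f A \is a fin_num.
Proof.
by rewrite ge0_fin_numE ?mass_ge0// (le_lt_trans (mass_le1 _ _))// ltry.
Qed.

(** Reduces the law of a map to the finitely many weights that enter the linear
    system. *)
Lemma mass_sum f A F n (v : nat -> S) :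
  measurable_map f -> set_bij `I_n F v -> mass f (~` F) = 0 ->
  mass f A = \sum_(i < n | v i \in A) mass f [set v i].
Proof.
move=> mf [vF vinj vsurj] fF.
pose E i := @Omega R `&` f @^-1` (A `&` [set v i]).
have -> : \sum_(i < n | v i \in A) mass f [set v i] =
    mass f (A `&` F).
  transitivity (\sum_(i < n) lambda (E i)).
    rewrite big_mkcond; apply: eq_bigr => i _; rewrite /E /mass.
    case: ifPn => [/set_mem Avi|/negP Avi].
      by rewrite (setIidr (_ : [set v i] `<=` A))// => _ ->.
    rewrite (_ : A `&` _ = set0) ?preimage_set0 ?setI0 ?lambda0//.
    by apply/seteqP; split=> // x [Ax xi]; apply: Avi; rewrite inE -xi.
  rewrite -(@measure_bigsetU_ord_cond _ _ _ (@completed_lebesgue_measure R)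
    n xpredT E) /=; last 2 first.
  - by move=> i _; exact: mf.
  - move=> i j _ _ [t [[_ [_ ti]] [_ [_ tj]]]]; apply/val_inj/vinj.
    + by rewrite inE; exact: ltn_ord.
    + by rewrite inE; exact: ltn_ord.
    + by rewrite -ti -tj.
  rewrite -bigcup_mkord; congr (lambda _); apply/seteqP; split=> t.
    move=> [i ltin [Ot [At ti]]]; split=> //; split=> //.
    by rewrite ti; exact: vF.
  by move=> [Ot [At /vsurj[i ltin vi]]]; exists i.
apply/eqP; rewrite eq_le; apply/andP; split; last first.
  by apply: le_mass => x [].
rewrite -[leRHS]adde0 -fF; apply: (le_trans _ (lambdaU_le _ _)).
apply: le_lambda => t [Ot At].
by have [Ft|Ft] := pselect (F (f t)); [left|right].
Qed.

(** The essential image itself need not be known: it is a subset of [F], its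
    complement is null because only finitely many points of [F] are involved,
    and therefore it is non-empty, so it is a face of [F]. *)
Lemma L_support K F f : simplicial_complex K -> K F ->
  measurable_map f -> mass f (~` F) = 0 -> L K f.
Proof.
move=> [_ Kfin Ksub] KF mf fF; have [finF F0] := Kfin _ KF.
have [n [v vF]] := finite_set_enum finF F0.
have ess0 : mass f (~` ess_image f) = 0.
  rewrite (mass_sum _ mf vF fF); apply: big1 => i /set_mem /=.
  by move=> /negP; rewrite -leNgt => le0; apply/eqP; rewrite eq_le le0 mass_ge0.
split=> //; apply: (Ksub F) => // [s fs|].
  apply: contrapT => Fs; move: fs; rewrite /ess_image /= => /lt_geF.
  by rewrite -fF (@le_mass f [set s])// => _ ->.
apply/set0P/negP => /eqP ess_empty; move: ess0.
by rewrite ess_empty setC0 mass_setT => /eqP; rewrite onee_eq0.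
Qed.

Lemma mass_le_dist f g F : mass f (~` F) <= dist f g + mass g (~` F).
Proof.
apply: (le_trans _ (lambdaU_le _ _)); apply: le_lambda => t [Ot Fft].
by have [fg|] := pselect (f t = g t); [right; rewrite /= -fg|left].
Qed.

(** A member of [L K] with essential image [G] differs from [f] at almost every
    point where [f] is outside [G], and the retraction of [f] onto a simplex [G]
    differs from [f] only at such points. *)
Lemma le_ereal_inf_dist K f (t : R) :
  simplicial_complex K -> measurable_map f ->
  t%:E <= ereal_inf [set dist f g | g in L K] <->
  forall G, K G -> t%:E <= mass f (~` G).
Proof.
move=> scK mf; split=> [tinf G KG|tG].
  have [s Gs] := (let: And3 _ Kfin _ := scK in Kfin _ KG).2.
  (* Keeping the values of [f] in [G] and sending the others to a fixed vertex
     of [G] gives the best approximation of [f] with values in [G]. *)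
  pose retract x := if x \in G then x else s.
  have retractG x : G (retract x).
    by rewrite /retract; case: ifPn => // /set_mem.
  apply: (le_trans tinf); apply: (@le_trans _ _ (dist f (retract \o f))).
    apply: ereal_inf_lbound; exists (retract \o f) => //.
    apply: (L_support scK KG); first by move=> A; exact: (mf (retract @^-1` A)).
    rewrite /mass (_ : _ @^-1` _ = set0) ?setI0 ?lambda0//.
    by apply/seteqP; split=> // u /(_ (retractG _)).
  apply: le_lambda => u [Ou fu]; split=> // Gfu; apply: fu.
  by rewrite /= /retract mem_set.
apply: le_ereal_inf_tmp => _ [g [_ Kg g0] <-].
by apply: (le_trans (tG _ Kg)); rewrite -[leRHS]adde0 -g0 mass_le_dist.
Qed.

(** Quantile construction: the value [v i] is taken on an interval of length
    [p i], these intervals being laid end to end. *)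
Lemma exists_map_law F n (v : nat -> S) (p : nat -> R) :
    set_bij `I_n F v -> (forall i, (i < n)%N -> (0 <= p i)%R) ->
    (\sum_(i < n) p i = 1)%R ->
  exists f, [/\ measurable_map f, mass f (~` F) = 0 &
    forall i, (i < n)%N -> mass f [set v i] = (p i)%:E].
Proof.
move=> [vF vinj vsurj] p0 p1.
pose c k : R := (\sum_(i < k) p i)%R.
have c0 : c 0%N = 0%R by rewrite /c big_ord0.
have cS k : (c k.+1 = c k + p k)%R by rewrite /c big_ord_recr.
have c_le i j : (i <= j)%N -> (j <= n)%N -> (c i <= c j)%R.
  elim: j => [|j IH]; first by rewrite leqn0 => /eqP ->.
  rewrite leq_eqVlt => /predU1P[->//|ij jn].
  by rewrite cS (le_trans (IH ij (ltnW jn)))// lerDl p0.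
(* The first interval whose right end is not exceeded. Level sets of [k] are
   the half-open intervals between partial sums, except that the point 0
   belongs to the first of them. *)
pose k (t : R) := find (fun i => (t <= c i.+1)%R) (iota 0 n).
have n0 : (0 < n)%N.
  by case: (n) p1 => //; rewrite big_ord0 => /esym/eqP; rewrite oner_eq0.
have k_lt t : @Omega R t -> (k t < n)%N.
  rewrite /Omega /= in_itv /= => /andP[_ t1].
  rewrite -[ltnRHS](size_iota 0) -has_find; apply/hasP; exists n.-1.
    by rewrite mem_iota /= add0n prednK.
  by rewrite prednK// /c p1.
have k_le t : @Omega R t -> (t <= c (k t).+1)%R.
  move=> Ot; have kn := k_lt _ Ot.
  have := @nth_find _ 0%N (fun i => (t <= c i.+1)%R) (iota 0 n).
  by rewrite has_find size_iota nth_iota// => /(_ kn).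
have k_gt t i : (i < k t)%N -> @Omega R t -> (c i.+1 < t)%R.
  move=> ik Ot; rewrite ltNge.
  have := before_find 0%N ik; rewrite nth_iota ?add0n => [->//|].
  exact: (ltn_trans ik (k_lt _ Ot)).
pose E i := @Omega R `&` [set t | k t = i].
have EE i : (i < n)%N -> E i = [set` `]c i, c i.+1]%R] `|` (E i `&` [set 0%R]).
  move=> ltin; apply/seteqP; split=> t; last first.
    move=> [|[]//]; rewrite /= in_itv /= => /andP[cit tci].
    have Ot : @Omega R t.
      rewrite /Omega /= in_itv /= (le_trans _ (ltW cit)) /=; last first.
        by rewrite -c0 c_le// ltnW.
      by rewrite (le_trans tci)// -p1 c_le.
    split=> //=; apply/eqP; rewrite eqn_leq; apply/andP; split.
      by rewrite leqNgt; apply/negP => /k_gt/(_ Ot); rewrite ltNge tci.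
    rewrite leqNgt; apply/negP => ki.
    have := le_lt_trans (le_trans (k_le _ Ot) (c_le _ _ ki (ltnW ltin))) cit.
    by rewrite ltxx.
  move=> [Ot kt]; have [t0|t0] := eqVneq t 0%R.
    by right.
  left; have := k_le _ Ot; rewrite kt /= in_itv /= => ->; rewrite andbT.
  case: i ltin kt => [|i] ltin kt; last by apply: k_gt => //; rewrite kt.
  rewrite c0 lt_neqAle eq_sym t0 /=.
  by move: Ot; rewrite /Omega /= in_itv /= => /andP[].
have mE i : (i < n)%N -> lebesgue_measurable (E i).
  move=> /EE ->; apply: measurableU; first exact: lebesgue_measurable_itv.
  exact: (@lebesgue_measurable_sub1 _ _ 0%R).
have lambdaE i : (i < n)%N -> lambda (E i) = (p i)%:E.
  move=> ltin; rewrite EE// lambdaU0; last first.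
    apply/eqP; rewrite eq_le lambda_ge0 andbT -(lambda_set1 (0%R : R)).
    exact: le_lambda.
  rewrite lambda_itv /= lte_fin cS ltrDl; case: ltP => [_|p0'].
    by rewrite -EFinD; congr EFin; rewrite addrC addKr.
  by congr EFin; apply/eqP; rewrite eq_le p0// p0'.
exists (v \o k); split.
- move=> A.
  have -> : @Omega R `&` (v \o k) @^-1` A =
      \bigcup_(i in `I_n `&` v @^-1` A) E i.
    apply/seteqP; split=> [t [Ot At]|t [i [ltin Ai] [Ot kt]]].
      by exists (k t) => //; split=> //; exact: k_lt.
    by split=> //=; rewrite kt.
  apply: fin_bigcup_measurable => [|i [ltin _]]; last exact: mE.
  exact/finite_setIl/finite_II.
- rewrite /mass (_ : _ `&` _ = set0) ?lambda0//.
  by apply/seteqP; split=> // t [/k_lt kn]; apply; exact: vF.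
- move=> i ltin; rewrite -lambdaE// /mass; congr lambda.
  apply/seteqP; split=> t [Ot vk]; split=> //=; last by rewrite /= vk.
  by apply: vinj => //; rewrite inE//; exact: k_lt.
Qed.

End Mass.

(** * Rationality of the distance *)

Section Game.
Variables (R : realType) (S : Type).
Implicit Types (F G : set S) (K : set (set S)).

(** The maximizing player's side of the game, with maps in place of mixed
    strategies: [delta K1 K2] is the greatest [t] that is attainable against
    [K2] on some [F] in [K1]. *)
Definition gap_attainable K F (t : R) : Prop :=
  exists f : R -> S, [/\ measurable_map f, mass f (~` F) = 0%E &
    forall G, K G -> (t%:E <= mass f (~` G))%E].

Definition coefs (a b : rat) (e : nat -> rat) (k : nat) : rat :=
  if k is k'.+1 then if k' is i.+1 then e i else b else a.

Lemma linear_form_coefs n a b e (x : nat -> R) :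
  linear_form n.+2 (coefs a b e) x =
  ratr a * x 0 + (ratr b * x 1 + \sum_(i < n) ratr (e i) * x i.+2).
Proof. by rewrite /linear_form !big_ord_recl. Qed.

(** The linear system of a matrix game with 0-1 payoffs: coordinate 0 is the
    homogenizing one and stands for the total mass, coordinate 1 is the
    guaranteed payoff, and the following [n] coordinates are the weights of a
    mixed strategy. *)
Definition game_cone n m (A : nat -> nat -> bool) : set (nat -> R) :=
  [set x | [/\ forall i, (i < n)%N -> 0 <= x i.+2,
               \sum_(i < n) x i.+2 = x 0 &
               forall j, (j < m)%N -> x 1 <= \sum_(i < n | A i j) x i.+2]].

Lemma rational_game_cone n m A : rational_cone n.+2 (game_cone n m A).
Proof.
pose pos i := [set x : nat -> R |
  0 <= linear_form n.+2 (coefs 0 0 (fun k => (k == i)%:R)) x].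
pose le1 := [set x : nat -> R |
  0 <= linear_form n.+2 (coefs 1 0 (fun=> - 1)) x].
pose ge1 := [set x : nat -> R |
  0 <= linear_form n.+2 (coefs (- 1) 0 (fun=> 1)) x].
pose pay j := [set x : nat -> R |
  0 <= linear_form n.+2 (coefs 0 (- 1) (fun i => (A i j)%:R)) x].
have -> : game_cone n m A =
    (\bigcap_(i < n) pos i) `&` (le1 `&` (ge1 `&` \bigcap_(j < m) pay j)).
  have posE i x : (i < n)%N -> pos i x <-> 0 <= x i.+2.
    move=> ltin; rewrite /pos /= linear_form_coefs rmorph0 !mul0r !add0r.
    rewrite (bigD1 (Ordinal ltin))//= eqxx rmorph1 mul1r big1 ?addr0// => j ji.
    rewrite (_ : (j == i :> nat) = false) ?rmorph0 ?mul0r//.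
    by apply: contra_neqF ji => /eqP ji; apply/val_inj.
  have le1E x : le1 x <-> \sum_(i < n) x i.+2 <= x 0.
    rewrite /le1 /= linear_form_coefs -mulr_sumr rmorphN !rmorph1 rmorph0.
    by rewrite mul1r mul0r add0r mulN1r subr_ge0.
  have ge1E x : ge1 x <-> x 0 <= \sum_(i < n) x i.+2.
    rewrite /ge1 /= linear_form_coefs -mulr_sumr rmorphN !rmorph1 rmorph0.
    by rewrite mul1r mul0r add0r mulN1r addrC subr_ge0.
  have payE j x : pay j x <-> x 1 <= \sum_(i < n | A i j) x i.+2.
    rewrite /pay /= linear_form_coefs rmorphN rmorph1 rmorph0.
    rewrite mulN1r mul0r add0r.
    rewrite [X in _ <-> _ <= X]big_mkcond /=.
    rewrite (eq_bigr (fun i : 'I_n => if A i j then x i.+2 else 0)) => [|i _].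
      by rewrite addrC subr_ge0.
    by case: (A i j); rewrite ?rmorph1 ?mul1r ?rmorph0 ?mul0r.
  apply/seteqP; split=> x.
    move=> [x0 x1 xp]; split.
      by move=> i ltin; apply/posE => //; exact: x0.
    split; first by apply/le1E; rewrite x1.
    by split; [apply/ge1E; rewrite x1|move=> j /xp/payE].
  move=> [x0 [/le1E xle [/ge1E xge xp]]]; split.
  - by move=> i ltin; apply/posE => //; exact: x0.
  - by apply/eqP; rewrite eq_le xle.
  - by move=> j /xp/payE.
by do ![apply: rational_coneI|apply: rational_cone_bigcap => ? _|
        exact: rational_cone_halfspace].
Qed.

(** The mixed strategies on [F] are exactly the laws of the maps with values in
    [F]. *)
Lemma gap_attainable_game n m (v : nat -> S) (w : nat -> set S) K F t :
  set_bij `I_n F v -> set_bij `I_m K w ->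
  gap_attainable K F t <->
  exists2 y : nat -> R, forall i, (i < 2)%N -> y i = nth 0 [:: 1; t] i
    & game_cone n m (fun i j => v i \in ~` w j) y.
Proof.
move=> vF [wK _ wsurj]; split.
  move=> [f [mf fF tf]].
  pose p i := fine (mass f [set v i]).
  have massE A : mass f A = (\sum_(i < n | v i \in A) p i)%:E.
    rewrite (mass_sum _ mf vF fF) -sumEFin; apply: eq_bigr => i _.
    by rewrite fineK ?mass_fin_num.
  exists (fun k => if k is k'.+1 then if k' is i.+1 then p i else t else 1).
    by move=> [|[|]].
  split=> [i _||j jm] /=.
  - by rewrite fine_ge0 ?mass_ge0.
  - have := massE setT; rewrite mass_setT => -[->].
    by apply: eq_bigl => i; rewrite mem_set.
  - by rewrite -lee_fin -massE; apply/tf/wK.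
move=> [y y01 [y0 y1 yp]].
have yt : y 1 = t by rewrite y01.
rewrite (y01 0)//= in y1.
have [//|f [mf fF fy]] := exists_map_law (p := fun i => y i.+2) vF y0.
exists f; split=> // G /wsurj[j jm <-].
rewrite (mass_sum _ mf vF fF).
rewrite (eq_bigr (fun i : 'I_n => (y i.+2)%:E)) => [|i _]; last exact: fy.
by rewrite sumEFin lee_fin -yt; exact: yp.
Qed.

(** A constant map attains 0 and no payoff exceeds 1, so that once the weights
    are eliminated the attainable payoffs form a half-line going down. *)
Lemma rational_game_value K F : finite_set K -> K !=set0 ->
  finite_set F -> F !=set0 ->
  exists q : rat, forall t, gap_attainable K F t <-> t <= ratr q.
Proof.
move=> finK K0 finF F0; have [[s Fs] [G KG]] := (F0, K0).
have [m [w wK]] := finite_set_enum finK K0.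
have [n [v vF]] := finite_set_enum finF F0.
have gapE t := gap_attainable_game t vF wK.
have [|t t'|t|q qP] := @rational_cone_ray R _ 0 1
  (@rational_cone_projections R 2 n _
    (@rational_game_cone n m (fun i j => v i \in ~` w j))).
- apply/gapE; exists (fun=> s); split=> [A||B _]; last exact: mass_ge0.
    have [As|As] := pselect (A s).
      rewrite (_ : _ `&` _ = @Omega R); first exact: lebesgue_measurable_itv.
      by apply/seteqP; split=> [? []|].
    rewrite (_ : _ `&` _ = set0); first exact: measurable0.
    by apply/seteqP; split=> [? []|].
  rewrite /mass (_ : _ `&` _ = set0) ?lambda0//.
  by apply/seteqP; split=> [? [_]|]//=; apply.
- move=> /gapE[f [mf fF tf]] t't; apply/gapE; exists f; split=> // B /tf.
  by apply: le_trans; rewrite lee_fin.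
- move=> /gapE[f [_ _ /(_ _ KG)]] tf.
  by rewrite -lee_fin (le_trans tf)// mass_le1.
by exists q => t; apply: (iff_trans (gapE t)); exact: qP.
Qed.

(** The supremum over all maps is a maximum over the finitely many simplices of
    [K1], because the payoff of each map is attainable on its own essential
    image and the value of each game is attained. *)
Lemma rational_delta K1 K2 : simplicial_complex K1 -> finite_set K1 ->
    simplicial_complex K2 -> finite_set K2 ->
  exists q : rat, delta R K1 K2 = (ratr q)%:E.
Proof.
move=> sc1 fin1 sc2 fin2.
have [[K10 K1F _] [K20 _ _]] := (sc1, sc2).
have /choice[q qP] : forall F, exists q : rat,
    K1 F -> forall t, gap_attainable K2 F t <-> t <= ratr q.
  move=> F; have [/K1F[finF F0]|] := pselect (K1 F); last by exists 0.
  by have [q qP] := rational_game_value fin2 K20 finF F0; exists q.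
have [F KF qmax] := finite_argmax q fin1 K10.
exists (q F); apply/eqP; rewrite eq_le; apply/andP; split.
  apply: ge_ereal_sup => _ [f [mf Kf f0] <-].
  have le_qF t : (t%:E <= ereal_inf [set dist f g | g in L K2])%E ->
      t <= ratr (q F).
    move=> /le_ereal_inf_dist tf.
    apply: (@le_trans _ _ (ratr (q (ess_image f)))); last first.
      by rewrite ler_rat qmax.
    by apply/qP => //; exists f; split=> //; exact: tf.
  case: ereal_inf le_qF => [r| |] le_qF; last exact: leNye.
    by rewrite lee_fin le_qF.
  by have := le_qF (ratr (q F) + 1) (leey _); rewrite leNgt ltrDl ltr01.
have [f [mf fF qf]] := (qP F KF (ratr (q F))).2 (lexx _).
apply: (le_trans ((le_ereal_inf_dist _ sc2 mf).2 qf)).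
by apply: ereal_sup_ubound; exists f => //; exact: L_support fF.
Qed.

End Game.

Theorem proposition2p11 (R : realType) (S : Type) (K1 K2 : set (set S))
    (hK1 : simplicial_complex K1) (fK1 : finite_set K1)
    (hK2 : simplicial_complex K2) (fK2 : finite_set K2) :
  exists q : rat, complex_dist R K1 K2 = EFin (ratr q).
Proof.
have [q12 q12E] := rational_delta R hK1 fK1 hK2 fK2.
have [q21 q21E] := rational_delta R hK2 fK2 hK1 fK1.
rewrite /complex_dist q12E q21E /maxe.
by case: ifP => _; [exists q21|exists q12].
Qed.
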